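(* Let $\Phi\in\mathbb{R}^{|\mathcal S|\times d}$ be a feature matrix, $H\ge1$, $\theta_0\in\mathbb{R}^d$, and deterministic stepsizes $\gamma_k\in(0,1]$ with $\sum_k\gamma_k=\infty$, $\sum_k\gamma_k^2<\infty$. Consider iterates: for $k\ge0$, let $\mu_{k+1}$ satisfy $T_{\mu_{k+1}}T^{H-1}\Phi\theta_k=T^H\Phi\theta_k$, let $\theta^{\mu_{k+1}}\in\mathbb{R}^d$ be a random vector (an estimate obtained from a trajectory of $\mu_{k+1}$), and set $\theta_{k+1}=(1-\gamma_k)\theta_k+\gamma_k\theta^{\mu_{k+1}}$. Let $\mathcal F_k$ be the filtration of the history up to iteration $k$ (so $\theta_k$ and $\mu_{k+1}$ are $\mathcal F_k$-measurable), and assume $\|\Phi\theta^{\mu_{k+1}}\|_\infty$ is bounded almost surely by a constant independent of $k$. Suppose there are constants $\delta_{app}>0$ and $\kappa>0$ with $$\beta:=\alpha^{H-1}+\kappa\frac{2\alpha^{H-1}}{1-\alpha}<1$$ and, for all $k$, almost surely, $$\big\|E[\Phi\theta^{\mu_{k+1}}\mid\mathcal F_k]-T^{H-1}\Phi\theta_k\big\|_\infty\le\kappa\big\|T^{H-1}\Phi\theta_k-J^{\mu_{k+1}}\big\|_\infty+\delta_{app}.$$ Then almost surely $$\limsup_{k\to\infty}\|\Phi\theta_k-J^*\|_\infty\le\frac{\delta_{app}}{1-\beta},\qquad \limsup_{k\to\infty}\|J^{\mu_k}-J^*\|_\infty\le\frac{2\alpha^{H-1}}{1-\alpha}\cdo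t\frac{\delta_{app}}{1-\beta}.$$
   Context: Finite Markov decision process with finite state space $\mathcal S$, finite action set $\mathcal A$, transition probabilities $P_{ij}(u)$, costs $g(i,u)\in[0,1]$, discount $\alpha\in(0,1)$. For a policy $\mu$, $T_\mu J=g_\mu+\alpha P_\mu J$ and $J^\mu$ is its fixed point; $(TJ)(i)=\min_u\big[g(i,u)+\alpha\sum_jP_{ij}(u)J(j)\big]$ with fixed point $J^*$. Powers denote compositions. The rows of $\Phi$ are feature vectors $\phi(i)^\top$, $i\in\mathcal S$. *)

(* Defs.v *)
From HB Require Import structures.
From mathcomp Require Import all_boot all_order all_algebra.
From mathcomp Require Import all_classical all_reals all_analysis.
Set Implicit Arguments. Unset Strict Implicit. Unset Printing Implicit Defensive.
Import Order.TTheory GRing.Theory Num.Theory.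
Import numFieldNormedType.Exports.
Local Open Scope classical_set_scope.
Local Open Scope ring_scope.

Section MDP.
Variables (R : realType) (S A : finType).

(* sup norm of J : R^S (0 if S is empty) *)
Definition supn (J : S -> R) : R := \big[Num.max/0]_(i : S) `|J i|.

Definition Qval (P : S -> A -> S -> R) (g : S -> A -> R) (alpha : R)
  (J : S -> R) (i : S) (u : A) : R :=
  g i u + alpha * \sum_(j : S) P i u j * J j.

Definition Tmu P g alpha (mu : S -> A) (J : S -> R) : S -> R :=
  fun i => Qval P g alpha J i (mu i).

Definition Tbell P g alpha (J : S -> R) : S -> R :=
  fun i => match [pick u : A] with
           | Some a0 => \big[Num.min/Qval P g alpha J i a0]_(u : A) Qval P g alpha J i u
           | None => 0
           end.

Definition Phiapp (d : nat) (Phi : S -> 'I_d -> R) (th : 'I_d -> R) : S -> R :=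
  fun i => \sum_(j < d) Phi i j * th j.

End MDP.

Section Prob.
Variables (dO : measure_display) (Omega : measurableType dO) (R : realType).

Definition sub_sigma (G : set (set Omega)) : Prop :=
  sigma_algebra setT G /\ (forall E, G E -> measurable E).

Definition G_measurable (G : set (set Omega)) (f : Omega -> R) : Prop :=
  forall B : set R, measurable B -> G (f @^-1` B).

Definition is_cond_exp (Pr : probability Omega R) (G : set (set Omega))
  (X Y : Omega -> R) : Prop :=
  G_measurable G Y /\ Pr.-integrable setT (EFin \o Y) /\
  forall E, G E ->
    (\int[Pr]_(w in E) (Y w)%:E = \int[Pr]_(w in E) (X w)%:E)%E.

End Prob.

(* Main.v *)
Require Import Defs.
From HB Require Import structures.
From mathcomp Require Import all_boot all_order all_algebra.
From mathcomp Require Import all_classical all_reals all_analysis.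
From mathcomp Require Import measurable_realfun ring lra.
Import Order.TTheory GRing.Theory Num.Theory.
Import numFieldNormedType.Exports.
Set Implicit Arguments. Unset Strict Implicit. Unset Printing Implicit Defensive.
Local Open Scope classical_set_scope.
Local Open Scope ring_scope.

(** Write [J k = Phi theta_k] and split the estimate [Phi theta^mu_{k+1}] into its
    conditional mean [Y k] and a bounded martingale difference. Greediness gives
    [|G - J^mu| <= 2 / (1 - alpha) * |G - J*|] for [G = T^(H-1) (J k)], so the bias
    bound becomes [|Y k - J*| <= beta * |J k - J*| + delta].

    The averaged noise [N (k+1) = (1 - gamma k) * N k + gamma k * W k] tends to [0]
    almost surely without the martingale convergence theorem:
    [N k ^ 2 + K ^ 2 * \sum_(j >= k) gamma j ^ 2] is a nonnegative supermartingale
    whose expectation tends to [0], so Doob's maximal inequality suffices.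

    Finally [z k = |J k - N k - J*|] satisfies
    [z (k+1) <= (1 - (1 - beta) * gamma k) * z k + gamma k * (delta + beta * |N k|)],
    whence [limsup z <= delta / (1 - beta)]. *)

(** * Sup norm of functions on a finite set *)

Section SupNorm.
Variables (R : realType) (S : finType).
Implicit Types J K L : S -> R.

Lemma le_supn J i : `|J i| <= supn J.
Proof. exact: (le_bigmax _ (fun i => `|J i|)). Qed.

Lemma supn_ge0 J : 0 <= supn J.
Proof. exact: bigmax_ge_id. Qed.

Lemma supn_le J c : 0 <= c -> (forall i, `|J i| <= c) -> supn J <= c.
Proof. by move=> c0 h; apply/bigmax_leP; split. Qed.

Lemma supn_triangle K J L :
  supn (fun i => J i - L i) <=
  supn (fun i => J i - K i) + supn (fun i => K i - L i).
Proof.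
apply: supn_le => [|i]; first by rewrite addr_ge0 ?supn_ge0.
have -> : J i - L i = (J i - K i) + (K i - L i) by ring.
apply: le_trans (ler_normD _ _) _.
by apply: lerD; [exact: (le_supn (fun i => J i - K i))|
                 exact: (le_supn (fun i => K i - L i))].
Qed.

Lemma supn_distC J K : supn (fun i => J i - K i) = supn (fun i => K i - J i).
Proof. by apply: eq_bigr => i _; rewrite distrC. Qed.

End SupNorm.

(** * Bellman operators: contraction and error bounds for greedy policies *)

Section Bellman.
Variables (R : realType) (S A : finType).
Variables (P : S -> A -> S -> R) (g : S -> A -> R) (alpha : R).
Hypothesis P_ge0 : forall i u j, 0 <= P i u j.
Hypothesis P_sum1 : forall i u, \sum_(j : S) P i u j = 1.
Hypothesis alpha01 : 0 < alpha < 1.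
Implicit Types J K : S -> R.

Local Notation T := (Tbell P g alpha).
Local Notation dist J K := (supn (fun i => J i - K i)).

Lemma Qval_contract J K i u :
  `|Qval P g alpha J i u - Qval P g alpha K i u| <= alpha * dist J K.
Proof.
case/andP: alpha01 => a0 _.
rewrite /Qval opprD addrACA subrr add0r -mulrBr normrM gtr0_norm// ler_pM2l//.
rewrite -sumrB; apply: le_trans (ler_norm_sum _ _ _) _.
rewrite -[leRHS]mul1r -(P_sum1 i u) mulr_suml; apply: ler_sum => j _.
rewrite -mulrBr normrM ger0_norm// ler_wpM2l//.
exact: (le_supn (fun i => J i - K i)).
Qed.

Lemma Tmu_contract nu J K :
  dist (Tmu P g alpha nu J) (Tmu P g alpha nu K) <= alpha * dist J K.
Proof.
case/andP: alpha01 => a0 _.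
by apply: supn_le => [|i]; [rewrite mulr_ge0 ?supn_ge0 ?ltW|exact: Qval_contract].
Qed.

(** Carries the bound of [Qval_contract] through the iterated minimum in [Tbell]. *)
Lemma dist_min (a b c x y : R) : `|a - x| <= c -> `|b - y| <= c ->
  `|Num.min a b - Num.min x y| <= c.
Proof.
rewrite !ler_norml => /andP[? ?] /andP[? ?].
by case: (leP a b) => ?; case: (leP x y) => ?; apply/andP; split; lra.
Qed.

Lemma Tbell_contract J K : dist (T J) (T K) <= alpha * dist J K.
Proof.
case/andP: alpha01 => a0 _.
have c0 : 0 <= alpha * dist J K by rewrite mulr_ge0 ?supn_ge0 ?ltW.
(* For empty [A] both sides take the default value 0. *)
apply: supn_le => // i; rewrite /Tbell; case: pickP => [u0 _|_]; last by rewrite subrr normr0.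
apply: (big_rec2 (fun x y => `|x - y| <= alpha * dist J K)).
  exact: Qval_contract.
by move=> u x y _ xy; apply: dist_min => //; exact: Qval_contract.
Qed.

Variables (Jmu : (S -> A) -> S -> R) (Jstar : S -> R).
Hypothesis Jmu_fix : forall nu, Tmu P g alpha nu (Jmu nu) = Jmu nu.
Hypothesis Jstar_fix : T Jstar = Jstar.

Lemma iter_Tbell_dist n J : dist (iter n T J) Jstar <= alpha ^+ n * dist J Jstar.
Proof.
case/andP: alpha01 => a0 _.
elim: n => [|n IH]; first by rewrite expr0 mul1r.
rewrite iterS -{1}Jstar_fix exprS -mulrA; apply: le_trans (Tbell_contract _ _) _.
by rewrite ler_pM2l.
Qed.

Section Greedy.
Variables (nu : S -> A) (G : S -> R).
Hypothesis greedy : Tmu P g alpha nu G = T G.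

(** Greediness makes [T G] the image of [G] under [Tmu nu], so it lies within
    [alpha * dist G (Jmu nu)] of [Jmu nu]; and [dist G (T G) <= (1 + alpha) * dist G Jstar]. Solving
    for [dist G (Jmu nu)] and using [1 + alpha <= 2] gives the factor. *)
Lemma greedy_dist_Jmu : dist G (Jmu nu) <= 2 / (1 - alpha) * dist G Jstar.
Proof.
case/andP: alpha01 => a0 a1.
have h1 := supn_triangle (T G) G (Jmu nu).
have h2 := Tmu_contract nu G (Jmu nu).
have h3 := supn_triangle Jstar G (T G).
have h4 := Tbell_contract Jstar G.
rewrite greedy Jmu_fix in h2; rewrite Jstar_fix (supn_distC Jstar G) in h4.
have s0 : 0 <= (1 - alpha) * dist G Jstar by rewrite mulr_ge0 ?supn_ge0// subr_ge0 ltW.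
rewrite mulrAC ler_pdivlMr ?subr_gt0//; lra.
Qed.

(** Going through [T G] gives [dist (Jmu nu) Jstar <= alpha * dist (Jmu nu) G + alpha * dist G
    Jstar]; a second triangle inequality leaves [2 * alpha / (1 - alpha)], which is relaxed to the
    same factor as in [greedy_dist_Jmu]. *)
Lemma greedy_dist_Jstar : dist (Jmu nu) Jstar <= 2 / (1 - alpha) * dist G Jstar.
Proof.
case/andP: alpha01 => a0 a1.
have h1 := supn_triangle (T G) (Jmu nu) Jstar.
have h2 := Tmu_contract nu (Jmu nu) G.
have h3 := supn_triangle Jstar (Jmu nu) G.
have h4 := Tbell_contract G Jstar.
rewrite greedy Jmu_fix in h2; rewrite Jstar_fix in h4.
rewrite (supn_distC Jstar G) in h3.
have h5 := ler_wpM2l (ltW a0) h3.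
have s0 : 0 <= (1 - alpha) * dist G Jstar by rewrite mulr_ge0 ?supn_ge0// subr_ge0 ltW.
rewrite mulrAC ler_pdivlMr ?subr_gt0//; lra.
Qed.

End Greedy.
End Bellman.

(** * A deterministic relaxation recursion with divergent stepsizes *)

Section Recursion.
Variable R : realType.

(* Multiplying by [1 + a * sum gamma] absorbs the factors [1 - a * gamma k],
   since [(1 - x) * (1 + s + x) <= 1 + s]. *)
Lemma relaxation_limsup (gamma x b : nat -> R) (a l : R) :
  0 < a <= 1 -> (forall k, 0 < gamma k <= 1) -> series gamma @ \oo --> +oo ->
  (forall k, x k.+1 <= (1 - a * gamma k) * x k + gamma k * b k) ->
  (forall e, 0 < e -> \forall k \near \oo, b k <= l + e) ->
  forall e, 0 < e -> \forall k \near \oo, x k <= l / a + e.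
Proof.
move=> /andP[a0 a1] hg gdiv hx hb e e0.
have ae0 : 0 < a * (e / 2) by rewrite mulr_gt0// divr_gt0.
have [K _ hK] := hb _ ae0.
(* [l / a + e / 2] is the fixed point of the recursion driven by the eventual bound
   [l + a * (e / 2)] on [b], so from [K] on the shifted [y] contracts homogeneously. [Y] is cut off
   at 0 so that the invariant [ys] also covers negative [y]. *)
pose y k := x k - (l / a + e / 2).
pose Y := Num.max (y K) 0.
pose s k := series gamma k - series gamma K.
have Y0 : 0 <= Y by rewrite le_max lexx orbT.
have sS k : s k.+1 = s k + gamma k by rewrite /s !seriesEnat/= big_nat_recr//=; ring.
have ys n : 0 <= s (K + n)%N /\ y (K + n)%N * (1 + a * s (K + n)%N) <= Y.
  elim: n => [|n [s0 IH]].
    by rewrite addn0 /s subrr mulr0 addr0 mulr1 le_max lexx.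
  have /andP[g0 g1] := hg (K + n)%N.
  rewrite addnS sS; split; first by rewrite addr_ge0// ltW.
  have yS : y (K + n).+1 <= (1 - a * gamma (K + n)%N) * y (K + n)%N.
    have h1 := hx (K + n)%N.
    have h2 : b (K + n)%N <= l + a * (e / 2) by apply: hK => /=; exact: leq_addr.
    have h3 : gamma (K + n)%N * b (K + n)%N <= gamma (K + n)%N * (l + a * (e / 2)).
      by rewrite ler_pM2l.
    apply: le_trans (lerB h1 (lexx _)) _.
    apply: le_trans (lerB (lerD (lexx _) h3) (lexx _)) _.
    rewrite le_eqVlt; apply/orP; left; apply/eqP; rewrite /y; field.
    by rewrite gt_eqF.
  move: yS IH s0 => {hK gdiv}.
  move: (y (K + n).+1) (y (K + n)%N) (s (K + n)%N) (gamma (K + n)%N) g0 g1.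
  move=> y' y0 t c g0 g1 yS IH s0.
  set z := a * c; set r := a * t.
  have z0 : 0 < z by rewrite mulr_gt0.
  have r0 : 0 <= r by rewrite mulr_ge0// ltW.
  have z1 : z <= 1 by rewrite /z; nra.
  rewrite -/r in IH; rewrite [a * (t + c)]mulrDr -/z -/r.
  have q0 : 0 < 1 + (r + z) by lra.
  apply: (@le_trans _ _ ((1 - z) * y0 * (1 + (r + z)))); first by rewrite ler_pM2r.
  have [y00|y00] := leP y0 0.
    apply: le_trans Y0; rewrite mulr_le0_ge0 ?(ltW q0)//.
    by rewrite mulr_ge0_le0// subr_ge0.
  apply: le_trans IH.
  have -> : (1 - z) * y0 * (1 + (r + z)) = y0 * (1 + r) - y0 * (z * (r + z)) by ring.
  by rewrite gerBl// mulr_ge0 ?ltW// mulr_gt0//; lra.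
(* At this threshold [a * s k * (e / 2) >= Y], so [y k > e / 2] would make [y k * (1 + a * s k)]
   exceed [Y], against [ys]. *)
have /cvgryPge/(_ (series gamma K + 2 * Y / (a * e))) [M _ hM] := gdiv.
exists (maxn K M) => // k /=; rewrite geq_max => /andP[Kk Mk].
have := ys (k - K)%N; rewrite subnKC// => -[s0 hy].
have sM : 2 * Y / (a * e) <= s k by rewrite lerBrDl; exact: hM.
rewrite ler_pdivrMr ?mulr_gt0// in sM.
have yk : y k <= e / 2.
  rewrite leNgt; apply/negP => yk.
  have : e / 2 * (1 + a * s k) < y k * (1 + a * s k).
    by rewrite ltr_pM2r// ltr_wpDr// mulr_ge0// ltW.
  have : e / 2 * (1 + a * s k) = e / 2 + s k * (a * e) / 2 by field.
  lra.
by move: yk; rewrite /y; lra.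
Qed.

End Recursion.

(** * Measurability with respect to a sub-sigma-algebra *)

Section SubSigma.
Variables (dO : measure_display) (Omega : measurableType dO) (R : realType).
Implicit Types (G : set (set Omega)) (f h : Omega -> R).

Lemma sub_sigma_measurable G : sub_sigma G ->
  @measurable _ (g_sigma_algebraType G) = G.
Proof. by move=> [sG _]; exact: sigma_algebra_id. Qed.

Lemma sub_sigmaT G : sub_sigma G -> G setT.
Proof. by move=> hG; rewrite -(sub_sigma_measurable hG); exact: measurableT. Qed.

Lemma sub_sigmaI G A B : sub_sigma G -> G A -> G B -> G (A `&` B).
Proof.
by move=> hG; rewrite -(sub_sigma_measurable hG); exact: measurableI.
Qed.

(** Closure properties of measurable functions transfer to [G_measurable] through the measurable
    type generated by [G], since a sigma-algebra generates itself. *)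
Lemma G_measurableP G f : sub_sigma G ->
  G_measurable G f <-> measurable_fun setT (f : g_sigma_algebraType G -> R).
Proof.
move=> hG; split=> [mf _ B mB|mf B mB].
  by rewrite setTI (sub_sigma_measurable hG); exact: mf.
have := mf (@measurableT _ (g_sigma_algebraType G)) B mB.
by rewrite setTI (sub_sigma_measurable hG).
Qed.

Lemma G_measurableW G f : sub_sigma G -> G_measurable G f -> measurable_fun setT f.
Proof. by move=> [_ hG] mf _ B mB; rewrite setTI; apply/hG/mf. Qed.

Lemma G_measurable_comp G (phi : R -> R) f :
  measurable_fun setT phi -> G_measurable G f -> G_measurable G (phi \o f).
Proof.
by move=> mphi mf B mB; apply: (mf (phi @^-1` B)); rewrite -[_ @^-1` _]setTI; exact: mphi.
Qed.

Lemma G_measurable_cst G (c : R) : sub_sigma G -> G_measurable G (fun=> c).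
Proof. by move=> hG; apply/(G_measurableP _ hG); exact: measurable_cst. Qed.

Lemma G_measurableD G f h : sub_sigma G -> G_measurable G f -> G_measurable G h ->
  G_measurable G (fun w => f w + h w).
Proof.
move=> hG /(G_measurableP _ hG) mf /(G_measurableP _ hG) mh.
by apply/(G_measurableP _ hG); exact: measurable_funD.
Qed.

Lemma G_measurableZ G c f : G_measurable G f -> G_measurable G (fun w => c * f w).
Proof. by apply: (@G_measurable_comp G (fun x => c * x)); exact: mulrl_measurable. Qed.

Lemma G_measurable_sum G n (f : 'I_n -> Omega -> R) : sub_sigma G ->
  (forall i, G_measurable G (f i)) -> G_measurable G (fun w => \sum_(i < n) f i w).
Proof.
move=> hG mf; apply/(G_measurableP _ hG).
by apply: measurable_sum => i; apply/(G_measurableP _ hG).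
Qed.

Lemma G_measurable_lt G f (c : R) : G_measurable G f -> G [set w | f w < c].
Proof.
move=> mf; have := mf `]-oo, c[%classic (measurable_itv _).
by congr G; apply/seteqP; split => w /=; rewrite in_itv.
Qed.

Lemma G_measurable_ge G f (c : R) : G_measurable G f -> G [set w | c <= f w].
Proof.
move=> mf; have := mf `[c, +oo[%classic (measurable_itv _).
by congr G; apply/seteqP; split => w /=; rewrite in_itv /= andbT.
Qed.

End SubSigma.

(** * Bounded functions: integrability and orthogonality to centred noise *)

Section BoundedFunctions.
Variables (dO : measure_display) (Omega : measurableType dO) (R : realType).
Variable Pr : probability Omega R.
Implicit Types (G : set (set Omega)) (f W : Omega -> R) (E : set Omega) (c K : R).

Lemma bounded_integrable f c E : measurable E -> measurable_fun setT f ->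
  (forall w, `|f w| <= c) -> Pr.-integrable E (EFin \o f).
Proof.
move=> mE mf fc; apply: measurable_bounded_integrable => //.
- by rewrite (le_lt_trans (probability_le1 Pr mE))// ltry.
- exact: measurable_funTS.
- by exists c; split; [exact: num_real|move=> x cx w _; exact: le_trans (ltW cx)].
Qed.

Lemma le_bounded_Rintegral f c E : measurable E -> measurable_fun setT f ->
  (forall w, `|f w| <= c) -> `|\int[Pr]_(w in E) f w| <= c.
Proof.
move=> mE mf fc.
have c0 : 0 <= c := le_trans (normr_ge0 _) (fc point).
apply: le_trans (le_normr_Rintegral mE (bounded_integrable mE mf fc)) _.
apply: (@le_trans _ _ (\int[Pr]_(w in E) c)).
  apply: le_Rintegral => //.
  - apply: (@bounded_integrable _ c) => //; first exact: measurableT_comp.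
    by move=> w; rewrite normr_id.
  - by apply: (@bounded_integrable _ c) => // w; rewrite ger0_norm.
rewrite Rintegral_cst// -[leRHS]mulr1 ler_wpM2l// -lee_fin fineK ?probability_le1//.
exact: fin_num_measure.
Qed.

(* Subtracting [c / 2] on the event [c / 2 <= f] halves the range of [f] and
   leaves the integral unchanged, so the integral is at most [c * K / 2 ^ n]
   for every [n]. *)
Lemma Rintegral_orthogonal_nonneg G W K f c E : sub_sigma G ->
  measurable_fun setT W -> (forall w, `|W w| <= K) ->
  (forall E', G E' -> \int[Pr]_(w in E') W w = 0) ->
  G_measurable G f -> (forall w, 0 <= f w <= c) -> G E ->
  \int[Pr]_(w in E) (f w * W w) = 0.
Proof.
move=> hG mW WK W0 mf fc GE.
have mE : measurable E by apply: hG.2.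
have K0 : 0 <= K := le_trans (normr_ge0 _) (WK point).
(* Quantified over [f'] and [c'] because the induction step applies it to [phi \o f] with bound
   [c / 2]. *)
have halving n : forall f' c', G_measurable G f' -> (forall w, 0 <= f' w <= c') ->
    `|\int[Pr]_(w in E) (f' w * W w)| <= c' * K / 2 ^+ n.
  elim: n => [|n IH] {mf fc}f {}c mf fc.
    rewrite expr0 divr1; apply: le_bounded_Rintegral => //.
      by apply: measurable_funM => //; exact: G_measurableW mf.
    move=> w; have /andP[f0 fcw] := fc w.
    by rewrite normrM ler_pM// ger0_norm.
  pose phi (x : R) := if c / 2 <= x then x - c / 2 else x.
  have mphi : measurable_fun setT phi.
    apply: measurable_fun_ifT => //; first exact: measurable_fun_ler.
    exact: measurable_funB.
  have h2 : forall w, 0 <= phi (f w) <= c / 2.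
    move=> w; have /andP[f0 fcw] := fc w; rewrite /phi.
    by case: (leP (c / 2) (f w)) => h; apply/andP; split; lra.
  have := IH (phi \o f) (c / 2) (G_measurable_comp mphi mf) h2.
  set E1 := E `&` [set w | c / 2 <= f w].
  have -> : \int[Pr]_(w in E) (f w * W w) =
      \int[Pr]_(w in E) ((phi \o f) w * W w) + c / 2 * \int[Pr]_(w in E1) W w.
    rewrite /E1 Rintegral_mkcondr -RintegralZl//; last first.
      apply: (@bounded_integrable _ K) => //.
        rewrite patch_indic; apply: measurable_funM => //.
        by apply: measurable_indic; apply: hG.2; exact: G_measurable_ge.
      by move=> w; rewrite patchE; case: ifP => // _; rewrite normr0.
    rewrite -RintegralD//.
    - apply: eq_Rintegral => w _ /=; rewrite patch_indic /= indicE /phi.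
      have -> : (w \in [set x | c / 2 <= f x]) = (c / 2 <= f w).
        by apply/idP/idP; rewrite inE.
      by case: (c / 2 <= f w) => /=; ring.
    - apply: (@bounded_integrable _ (c / 2 * K)) => //.
        apply: measurable_funM => //; apply: G_measurableW hG _.
        exact: G_measurable_comp.
      move=> w; have /andP[p0 pc] := h2 w.
      by rewrite normrM ler_pM//= ger0_norm.
    - apply: (@bounded_integrable _ (`|c / 2| * K)) => //.
        apply: measurable_funM => //.
        rewrite patch_indic; apply: measurable_funM => //.
        by apply: measurable_indic; apply: hG.2; exact: G_measurable_ge.
      move=> w; rewrite normrM ler_wpM2l// patchE; case: ifP => // _.
      by rewrite normr0.
  rewrite W0 ?mulr0 ?addr0; last by apply: sub_sigmaI => //; exact: G_measurable_ge.
  move/le_trans; apply; rewrite exprS invfM.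
  by rewrite le_eqVlt; apply/orP; left; apply/eqP; ring.
apply/eqP; rewrite -normr_le0; apply/ler_addgt0Pl => e e0; rewrite addr0.
have c0 : 0 <= c by have /andP[] := fc point; exact: le_trans.
have [n hn] : exists n, c * K / 2 ^+ n <= e.
  have := @cvg_geometric R (c * K) 2^-1 _.
  rewrite gtr0_norm// invf_lt1// ltr1n => /(_ isT) /cvgrPdist_le /(_ _ e0).
  move=> [n _ /(_ n (leqnn _))]; rewrite sub0r normrN /= exprVn => h.
  by exists n; apply: le_trans h; exact: ler_norm.
exact: le_trans (halving n _ _ mf fc) hn.
Qed.

(** The shift [f + c] has values between 0 and [c + c], and the added term [c * W] integrates to 0
    over [E]. *)
Lemma Rintegral_orthogonal G W K f c E : sub_sigma G ->
  measurable_fun setT W -> (forall w, `|W w| <= K) ->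
  (forall E', G E' -> \int[Pr]_(w in E') W w = 0) ->
  G_measurable G f -> (forall w, `|f w| <= c) -> G E ->
  \int[Pr]_(w in E) (f w * W w) = 0.
Proof.
move=> hG mW WK W0 mf fc GE.
have mE : measurable E by apply: hG.2.
have mf' := G_measurableW hG mf.
have c0 : 0 <= c := le_trans (normr_ge0 _) (fc point).
have fK w : `|f w * W w| <= c * K by rewrite normrM ler_pM.
have := @Rintegral_orthogonal_nonneg G W K (fun w => f w + c) (c + c) E hG mW WK W0 _ _ GE.
have -> : \int[Pr]_(w in E) ((f w + c) * W w) =
    \int[Pr]_(w in E) (f w * W w) + c * \int[Pr]_(w in E) W w.
  rewrite -RintegralZl//; last exact: (@bounded_integrable _ K).
  rewrite -RintegralD//.
  - by apply: eq_Rintegral => w _; ring.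
  - by apply: (@bounded_integrable _ (c * K)) => //; exact: measurable_funM.
  - apply: (@bounded_integrable _ (c * K)) => //; first exact: measurable_funM.
    by move=> w; rewrite normrM ler_pM// ger0_norm.
rewrite W0// mulr0 addr0; apply.
- by apply: G_measurableD => //; exact: G_measurable_cst.
- by move=> w; have := fc w; rewrite ler_norml => /andP[? ?]; apply/andP; split; lra.
Qed.

End BoundedFunctions.

(** * Nonnegative bounded supermartingales *)

Section Supermartingale.
Variables (dO : measure_display) (Omega : measurableType dO) (R : realType).
Variable Pr : probability Omega R.

Lemma Rintegral_setT_cst (c : R) : \int[Pr]_(w in setT) c = c.
Proof. by rewrite Rintegral_cst//= (@probability_setT _ _ _ Pr) mulr1. Qed.

(* Doob's maximal inequality, obtained by stopping the process when it first
   reaches [lambda]: [\int_(D m) (M m - lambda)] is nonincreasing in [m], where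
   [D m] is the event that [lambda] has not been reached by time [m]. *)
Lemma supermartingale_maximal (F : nat -> set (set Omega))
    (M : nat -> Omega -> R) (c lambda : R) :
  (forall k, sub_sigma (F k)) -> (forall k, F k `<=` F k.+1) ->
  (forall k, G_measurable (F k) (M k)) ->
  (forall k w, 0 <= M k w <= c) ->
  (forall k E, F k E -> \int[Pr]_(w in E) M k.+1 w <= \int[Pr]_(w in E) M k w) ->
  0 < lambda ->
  forall m, lambda * fine (Pr [set w | exists2 j, (j <= m)%N & lambda <= M j w])
            <= \int[Pr]_(w in setT) M 0%N w.
Proof.
move=> hF Fmono mM Mc Msup l0 m.
pose D k := [set w | forall j, (j <= k)%N -> M j w < lambda].
have D0 : D 0%N = [set w | M 0%N w < lambda].
  by apply/seteqP; split => w /= h; [exact: h|move=> j; rewrite leqn0 => /eqP ->].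
have DS k : D k.+1 = D k `&` [set w | M k.+1 w < lambda].
  apply/seteqP; split => w /=; first by move=> h; split=> [j jk|]; apply: h; rewrite // leqW.
  by move=> [h1 h2] j; rewrite leq_eqVlt ltnS => /predU1P[->//|]; exact: h1.
have FD k : F k (D k).
  elim: k => [|k IH]; first by rewrite D0; exact: G_measurable_lt.
  rewrite DS; apply: sub_sigmaI => //; first exact: Fmono.
  exact: G_measurable_lt.
have mD k : measurable (D k) by apply: (hF k).2.
have mMk k : measurable_fun setT (M k) := G_measurableW (hF k) (mM k).
have c0 : 0 <= c by have /andP[] := Mc 0%N point; exact: le_trans.
have iM k E : measurable E -> Pr.-integrable E (EFin \o M k).
  move=> mE; apply: (@bounded_integrable _ _ _ _ _ c) => // w.
  by have /andP[? ?] := Mc k w; rewrite ger0_norm.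
have icst (r : R) E : measurable E -> Pr.-integrable E (EFin \o fun=> r).
  by move=> mE; apply: (@bounded_integrable _ _ _ _ _ `|r|).
have iMl k E : measurable E -> Pr.-integrable E (EFin \o (fun w => M k w - lambda)).
  move=> mE; apply: (@bounded_integrable _ _ _ _ _ (c + lambda)) => //.
    exact: measurable_funB.
  move=> w; apply: le_trans (ler_normB _ _) _.
  have /andP[? ?] := Mc k w.
  by rewrite (ger0_norm (ltW l0)) ger0_norm// lerD2r.
have IB k E : measurable E -> \int[Pr]_(w in E) (M k w - lambda) =
    \int[Pr]_(w in E) M k w - \int[Pr]_(w in E) lambda.
  by move=> mE; rewrite RintegralB//; [exact: iM|exact: icst].
(* On the part of [E] that is discarded, [M k - lambda] is nonnegative. *)
have drop k E : measurable E ->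
    \int[Pr]_(w in E `&` [set w | M k w < lambda]) (M k w - lambda) <=
    \int[Pr]_(w in E) (M k w - lambda).
  move=> mE.
  have mlt : measurable [set w | M k w < lambda].
    by apply: (hF k).2; exact: G_measurable_lt.
  rewrite -{2}(setIT E) -(setUv [set w | M k w < lambda]) setIUr Rintegral_setU//.
  - rewrite lerDl; apply: Rintegral_ge0 => w [_ /negP].
    by rewrite -leNgt subr_ge0.
  - exact: measurableI.
  - by apply: measurableI => //; exact: measurableC.
  - by rewrite -setIUr setUv setIT; exact: iMl.
  - by apply/disj_setPRL => w [_ +] [_].
have stopped k : \int[Pr]_(w in D k) (M k w - lambda) <=
    \int[Pr]_(w in setT) (M 0%N w - lambda).
  elim: k => [|k IH]; first by rewrite D0 -(setTI [set w | _]); exact: drop.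
  (* First [drop] at time [k.+1] inside [D k], then the supermartingale inequality on [D k], an
     event of [F k]. *)
  rewrite DS; apply: le_trans (drop _ _ (mD k)) _; apply: le_trans IH.
  by rewrite !IB// lerD2r; exact: Msup.
have := stopped m; rewrite !IB// Rintegral_setT_cst Rintegral_cst//.
have -> : [set w | exists2 j, (j <= m)%N & lambda <= M j w] = ~` D m.
  apply/seteqP; split => w /=.
    by move=> [j jm h] /(_ j jm); rewrite ltNge h.
  by move=> /existsNP[j /not_implyP[jm /negP]]; rewrite -leNgt => h; exists j.
rewrite probability_setC// fineB ?fin_num_measure//=.
(* Dropping this integral from [stopped m] leaves [lambda * (1 - Pr (D m))] below the initial
   expectation. *)
have : 0 <= \int[Pr]_(w in D m) M m w.
  by apply: Rintegral_ge0 => w _; have /andP[] := Mc m w.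
lra.
Qed.

(** Restarted at time [n], the maximal inequality bounds the probability of reaching level [l] from
    then on by [l^-1] times the expectation of [M n], which becomes arbitrarily small. So reaching
    [l] infinitely often is negligible, and the countably many levels [k.+1%:R^-1] suffice. *)
Lemma supermartingale_cvg0 (F : nat -> set (set Omega))
    (M : nat -> Omega -> R) (c : R) :
  (forall k, sub_sigma (F k)) -> (forall k, F k `<=` F k.+1) ->
  (forall k, G_measurable (F k) (M k)) ->
  (forall k w, 0 <= M k w <= c) ->
  (forall k E, F k E -> \int[Pr]_(w in E) M k.+1 w <= \int[Pr]_(w in E) M k w) ->
  (forall e, 0 < e -> \forall k \near \oo, \int[Pr]_(w in setT) M k w <= e) ->
  {ae Pr, forall w, forall e, 0 < e -> \forall k \near \oo, M k w < e}.
Proof.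
move=> hF Fmono mM Mc Msup M0.
pose A l n m := [set w | exists2 j, (j <= m)%N & l <= M (n + j)%N w].
have mA l n m : measurable (A l n m).
  have -> : A l n m = \bigcup_(j in [set j | (j <= m)%N]) [set w | l <= M (n + j)%N w].
    by apply/seteqP; split => w [j]; exists j.
  by apply: bigcup_measurable => j _; apply: (hF (n + j)%N).2; exact: G_measurable_ge.
have mUA l n : measurable (\bigcup_m A l n m) by exact: bigcupT_measurable.
have PA l n m : 0 < l -> (Pr (A l n m) <= (l^-1 * \int[Pr]_(w in setT) M n w)%:E)%E.
  move=> l0.
  have := @supermartingale_maximal (fun k => F (n + k)%N) (fun k => M (n + k)%N) c l.
  move=> /(_ (fun k => hF _)) h.
  rewrite -[Pr _]fineK ?fin_num_measure// lee_fin ler_pdivlMl//.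
  rewrite -[M n]/(M n) -{2}(addn0 n); apply: h => // k; rewrite ?addnS.
  - exact: Fmono.
  - by move=> E; exact: Msup.
have PUA l n : 0 < l -> (Pr (\bigcup_m A l n m) <= (l^-1 * \int[Pr]_(w in setT) M n w)%:E)%E.
  move=> l0.
  have /cvg_lim <- // : Pr \o A l n @ \oo --> Pr (\bigcup_m A l n m).
    apply: nondecreasing_cvg_mu => //.
    move=> i j ij; apply/subsetPset => w [k ki h]; exists k => //.
    exact: leq_trans ij.
  apply: lime_le; last by apply: nearW => m; exact: PA.
  apply/cvg_ex; exists (Pr (\bigcup_m A l n m)).
  apply: nondecreasing_cvg_mu => //.
  move=> i j ij; apply/subsetPset => w [k ki h]; exists k => //.
  exact: leq_trans ij.
have negl l : 0 < l -> Pr.-negligible (\bigcap_n \bigcup_m A l n m).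
  move=> l0.
  have mB : measurable (\bigcap_n \bigcup_m A l n m) by exact: bigcapT_measurable.
  apply/negligibleP => //; apply/eqP; rewrite -measure_le0.
  apply/lee_addgt0Pr => e e0; rewrite add0e.
  have [n _ /(_ n (leqnn _)) hn] := M0 (l * e) (mulr_gt0 l0 e0).
  apply: (@le_trans _ _ (Pr (\bigcup_m A l n m))).
    by apply: le_measure; rewrite ?inE//; exact: bigcap_inf.
  apply: le_trans (PUA _ _ l0) _.
  by rewrite lee_fin ler_pdivrMl.
have : Pr.-negligible (\bigcup_k \bigcap_n \bigcup_m A k.+1%:R^-1 n m).
  by apply: negligible_bigcup => k; apply: negl; rewrite invr_gt0.
apply: negligibleS => w /= /existsNP[e /not_implyP[e0 he]].
have [k _ /(_ k (leqnn _)) /= hk] := near_infty_natSinv_lt (PosNum e0).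
exists k => // n _; apply: contrapT => hn; apply: he.
exists n => // j /= nj; rewrite ltNge; apply/negP => hj; apply: hn.
exists (j - n)%N => //; exists (j - n)%N => //; rewrite subnKC//.
exact/ltW/(lt_le_trans hk).
Qed.

End Supermartingale.

(** * Almost sure vanishing of the averaged noise *)

Section AveragedNoise.
Variables (dO : measure_display) (Omega : measurableType dO) (R : realType).
Variable Pr : probability Omega R.
Variables (gamma : nat -> R) (W : nat -> Omega -> R).

Fixpoint averaged_noise (k : nat) (w : Omega) : R :=
  if k is k'.+1 then (1 - gamma k') * averaged_noise k' w + gamma k' * W k' w
  else 0.

Local Notation N := averaged_noise.

Variables (F : nat -> set (set Omega)) (K : R).
Hypothesis gamma01 : forall k, 0 < gamma k <= 1.
Hypothesis gamma_div : series gamma @ \oo --> +oo.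
Hypothesis gamma_sq : cvgn (series (fun k => gamma k ^+ 2)).
Hypothesis F_sub : forall k, sub_sigma (F k).
Hypothesis F_mono : forall k, F k `<=` F k.+1.
Hypothesis W_meas : forall k, G_measurable (F k.+1) (W k).
Hypothesis W_bound : forall k w, `|W k w| <= K.
Hypothesis W_mean0 : forall k E, F k E -> \int[Pr]_(w in E) W k w = 0.

Lemma averaged_noise_bound k w : `|N k w| <= K.
Proof.
elim: k => [|k IH] /=; first by rewrite normr0; exact: le_trans (W_bound 0%N w).
have /andP[g0 g1] := gamma01 k.
apply: le_trans (ler_normD _ _) _; rewrite !normrM (gtr0_norm g0) ger0_norm ?subr_ge0//.
have -> : K = (1 - gamma k) * K + gamma k * K by ring.
by apply: lerD; apply: ler_wpM2l; rewrite ?subr_ge0// ltW.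
Qed.

Lemma averaged_noise_measurable k : G_measurable (F k) (N k).
Proof.
elim: k => [|k IH] /=; first exact: G_measurable_cst.
apply: G_measurableD => //; apply: G_measurableZ; last exact: W_meas.
by move=> B mB; exact/F_mono/IH.
Qed.

(** In the expanded square the cross term vanishes, since [N k] is [F k]-measurable and [W k]
    integrates to 0 over events of [F k]. One factor [1 - gamma k] is kept: it drives the
    expectation to 0, while bounding it by 1 gives the supermartingale property. *)
Lemma averaged_noise_sq k E : F k E ->
  \int[Pr]_(w in E) (N k.+1 w ^+ 2) <=
  (1 - gamma k) * (\int[Pr]_(w in E) (N k w ^+ 2)) +
  gamma k ^+ 2 * \int[Pr]_(w in E) (K ^+ 2).
Proof.
move=> FE.
have mE : measurable E by apply: (F_sub k).2.
have /andP[g0 g1] := gamma01 k.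
have K0 : 0 <= K := le_trans (normr_ge0 _) (W_bound 0%N point).
have mN : measurable_fun setT (N k) := G_measurableW (F_sub k) (@averaged_noise_measurable k).
have mN1 : measurable_fun setT (N k.+1) :=
  G_measurableW (F_sub k.+1) (@averaged_noise_measurable k.+1).
have mW : measurable_fun setT (W k) := G_measurableW (F_sub k.+1) (@W_meas k).
have sq x : `|x| <= K -> `|x ^+ 2| <= K ^+ 2.
  by move=> h; rewrite normrX ler_pXn2r ?nnegrE.
have iN : Pr.-integrable E (EFin \o fun w => N k w ^+ 2).
  apply: (@bounded_integrable _ _ _ _ _ (K ^+ 2)) => //; first exact: measurable_funX.
  by move=> w; exact/sq/averaged_noise_bound.
have iN1 : Pr.-integrable E (EFin \o fun w => N k.+1 w ^+ 2).
  apply: (@bounded_integrable _ _ _ _ _ (K ^+ 2)) => //; first exact: measurable_funX.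
  by move=> w; exact/sq/averaged_noise_bound.
have iNW : Pr.-integrable E (EFin \o fun w => N k w * W k w).
  apply: (@bounded_integrable _ _ _ _ _ (K * K)) => //; first exact: measurable_funM.
  by move=> w; rewrite normrM ler_pM// averaged_noise_bound.
have iK : Pr.-integrable E (EFin \o fun=> K ^+ 2).
  by apply: (@bounded_integrable _ _ _ _ _ (K ^+ 2)) => // w; rewrite ger0_norm ?sqr_ge0.
have iZ (c : R) f : Pr.-integrable E (EFin \o f) ->
    Pr.-integrable E (EFin \o fun w => c * f w).
  by move=> hf; have := integrableZl mE c hf; apply: eq_integrable.
have iD f h : Pr.-integrable E (EFin \o f) -> Pr.-integrable E (EFin \o h) ->
    Pr.-integrable E (EFin \o fun w => f w + h w).
  by move=> hf hh; have := integrableD mE hf hh; apply: eq_integrable.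
have orth : \int[Pr]_(w in E) (N k w * W k w) = 0.
  apply: (@Rintegral_orthogonal _ _ _ _ (F k) _ K _ K) => //.
  - exact: W_mean0.
  - exact: averaged_noise_measurable.
  - exact: averaged_noise_bound.
have -> : (1 - gamma k) * (\int[Pr]_(w in E) (N k w ^+ 2)) +
    gamma k ^+ 2 * \int[Pr]_(w in E) (K ^+ 2) =
    \int[Pr]_(w in E) ((1 - gamma k) * N k w ^+ 2 +
      (2 * gamma k * (1 - gamma k)) * (N k w * W k w) + gamma k ^+ 2 * K ^+ 2).
  rewrite RintegralD//; [|by apply: iD; exact: iZ|exact: iZ].
  rewrite RintegralD//; [|exact: iZ|exact: iZ].
  rewrite (RintegralZl (1 - gamma k) mE iN) (RintegralZl (2 * gamma k * (1 - gamma k)) mE iNW).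
  by rewrite (RintegralZl (gamma k ^+ 2) mE iK) orth mulr0 addr0.
apply: le_Rintegral => //.
  by apply: (iD); [apply: iD; exact: iZ|exact: iZ].
move=> w _ /=.
have h1 : W k w ^+ 2 <= K ^+ 2 by apply: le_trans (ler_norm _) _; exact: sq.
have h2 : 0 <= gamma k ^+ 2 * (K ^+ 2 - W k w ^+ 2).
  by rewrite mulr_ge0 ?sqr_ge0// subr_ge0.
have h3 : 0 <= gamma k * (1 - gamma k) * N k w ^+ 2.
  by apply: mulr_ge0 (sqr_ge0 _); apply: mulr_ge0; rewrite ?subr_ge0 ?(ltW g0).
lra.
Qed.

Lemma averaged_noise_cvg0 :
  {ae Pr, forall w, forall e, 0 < e -> \forall k \near \oo, `|N k w| <= e}.
Proof.
have K0 : 0 <= K := le_trans (normr_ge0 _) (W_bound 0%N point).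
pose s := series (fun k => gamma k ^+ 2).
(* The tail of the sum of squares; its decrement [gamma k ^+ 2], times [K ^+ 2], pays for the last
   term of [averaged_noise_sq]. *)
pose t k := limn s - s k.
have sS k : s k.+1 = s k + gamma k ^+ 2 by rewrite /s !seriesEnat/= big_nat_recr.
have s_nd : nondecreasing_seq s.
  by apply/nondecreasing_seqP => k; rewrite sS lerDl sqr_ge0.
have t0 k : 0 <= t k by rewrite subr_ge0; exact: nondecreasing_cvgn_le.
have tS k : t k.+1 = t k - gamma k ^+ 2 by rewrite /t sS; ring.
have t_le k : t k <= t 0%N by rewrite lerB// s_nd.
pose M k w := N k w ^+ 2 + K ^+ 2 * t k.
have mN k : measurable_fun setT (N k) := G_measurableW (F_sub k) (@averaged_noise_measurable k).
have sq x : `|x| <= K -> `|x ^+ 2| <= K ^+ 2.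
  by move=> h; rewrite normrX ler_pXn2r ?nnegrE.
have iN k E : measurable E -> Pr.-integrable E (EFin \o fun w => N k w ^+ 2).
  move=> mE; apply: (@bounded_integrable _ _ _ _ _ (K ^+ 2)) => //; first exact: measurable_funX.
  by move=> w; exact/sq/averaged_noise_bound.
have icst (r : R) E : measurable E -> Pr.-integrable E (EFin \o fun=> r).
  by move=> mE; apply: (@bounded_integrable _ _ _ _ _ `|r|).
have IM k E : measurable E -> \int[Pr]_(w in E) M k w =
    \int[Pr]_(w in E) (N k w ^+ 2) + t k * \int[Pr]_(w in E) (K ^+ 2).
  move=> mE; rewrite RintegralD ?Rintegral_cst//; [|exact: iN|exact: icst].
  by congr (_ + _); ring.
have gamma_sq0 e : 0 < e -> \forall k \near \oo, gamma k * K ^+ 2 <= 0 + e.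
  move=> e0; rewrite add0r.
  have /cvgrPdist_le h := cvg_series_cvg_0 gamma_sq.
  (* The [+ 1] keeps the denominator positive when [K = 0]. *)
  have d0 : 0 < e / (K ^+ 2 + 1) by rewrite divr_gt0// ltr_wpDl// sqr_ge0.
  have := h _ (exprn_gt0 2 d0); apply: filterS => k.
  rewrite sub0r normrN ger0_norm ?sqr_ge0// ler_pXn2r ?nnegrE ?(ltW d0)//; last first.
    by have /andP[/ltW] := gamma01 k.
  rewrite ler_pdivlMr ?ltr_wpDl ?sqr_ge0//; apply: le_trans.
  by have /andP[g0 _] := gamma01 k; rewrite ler_pM2l// lerDl.
(* Over the whole space [averaged_noise_sq] is the relaxation recursion with [a = 1], [l = 0] and
   drive [gamma k * K ^+ 2], which tends to 0 because [gamma] does. *)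
have EN0 := @relaxation_limsup R gamma (fun k => \int[Pr]_(w in setT) (N k w ^+ 2))
  (fun k => gamma k * K ^+ 2) 1 0 _ gamma01 gamma_div _ gamma_sq0.
have {}EN0 e : 0 < e -> \forall k \near \oo, \int[Pr]_(w in setT) (N k w ^+ 2) <= e.
  have -> : e = 0 / 1 + e by rewrite mul0r add0r.
  rewrite {1}mul0r add0r; apply: EN0; rewrite ?ltr01 ?lexx// => k.
  rewrite mul1r; have := averaged_noise_sq (sub_sigmaT (F_sub k)).
  by rewrite Rintegral_setT_cst mulrA expr2.
have : {ae Pr, forall w, forall e, 0 < e -> \forall k \near \oo, M k w < e}.
  apply: (@supermartingale_cvg0 _ _ _ _ F M (K ^+ 2 + K ^+ 2 * t 0%N)) => //.
  - move=> k; apply: G_measurableD => //; last exact: G_measurable_cst.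
    apply: (@G_measurable_comp _ _ _ _ (fun x => x ^+ 2)).
      exact: measurable_funX.
    exact: averaged_noise_measurable.
  - move=> k w; rewrite /M (addr_ge0 (sqr_ge0 _) (mulr_ge0 (sqr_ge0 _) (t0 k)))/=.
    apply: lerD; last by rewrite ler_wpM2l ?sqr_ge0.
    by apply: le_trans (ler_norm _) _; exact/sq/averaged_noise_bound.
  - move=> k E FE; have mE : measurable E by apply: (F_sub k).2.
    rewrite !IM// tS; have := averaged_noise_sq FE.
    have : 0 <= \int[Pr]_(w in E) (N k w ^+ 2).
      by apply: Rintegral_ge0 => w _; exact: sqr_ge0.
    have /andP[g0 _] := gamma01 k.
    move=> /(mulr_ge0 (ltW g0)); lra.
  - move=> e e0.
    have e20 : 0 < e / 2 by rewrite divr_gt0.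
    have d0 : 0 < e / 2 / (K ^+ 2 + 1) by rewrite divr_gt0// ltr_wpDl// sqr_ge0.
    have /cvgrPdist_le /(_ _ d0) := gamma_sq.
    apply: filterS2 (EN0 _ e20) => k h1 h2.
    rewrite IM// Rintegral_setT_cst.
    have {}h2 : t k <= e / 2 / (K ^+ 2 + 1) by apply: le_trans h2; exact: ler_norm.
    rewrite ler_pdivlMr ?ltr_wpDl ?sqr_ge0// in h2.
    have := t0 k; lra.
apply: filterS => w hw e e0; have := hw _ (exprn_gt0 2 e0); apply: filterS => k hk.
rewrite -(@ler_pXn2r _ 2) ?nnegrE ?(ltW e0)// real_normK ?num_real//.
apply: le_trans (ltW hk); rewrite lerDl mulr_ge0 ?sqr_ge0//.
Qed.

End AveragedNoise.

(** [limn_esup] is an infimum of suprema over the neighbourhoods of infinity, and the set where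
    [u k <= l + e] is one of them. *)
Lemma limn_esup_le_near (R : realType) (u : nat -> R) (l : R) :
  (forall e, 0 < e -> \forall k \near \oo, u k <= l + e) ->
  (limn_esup (fun k => (u k)%:E) <= l%:E)%E.
Proof.
move=> hu; apply/lee_addgt0Pr => e e0; have {}hu := hu e e0.
apply: (@le_trans _ _ (ereal_sup ((fun k => (u k)%:E) @` [set k | u k <= l + e]))).
  by apply: ereal_inf_lbound; exists [set k | u k <= l + e].
by apply: ge_ereal_sup => _ [k /= hk <-]; rewrite -EFinD lee_fin.
Qed.

(** * Pathwise analysis of the noisy iteration *)

Section Pathwise.
Variables (R : realType) (S : finType).
Variables (gamma : nat -> R) (J X Y N : nat -> S -> R) (Jstar : S -> R).
Variables (beta delta : R).
Hypothesis gamma01 : forall k, 0 < gamma k <= 1.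
Hypothesis gamma_div : series gamma @ \oo --> +oo.
Hypothesis beta01 : 0 <= beta < 1.
Hypothesis JS : forall k i, J k.+1 i = (1 - gamma k) * J k i + gamma k * X k i.
Hypothesis NS : forall k i,
  N k.+1 i = (1 - gamma k) * N k i + gamma k * (X k i - Y k i).
Hypothesis Y_bias : forall k, supn (fun i => Y k i - Jstar i) <=
  beta * supn (fun i => J k i - Jstar i) + delta.
Hypothesis N_cvg0 : forall i e, 0 < e -> \forall k \near \oo, `|N k i| <= e.

(* [J - N] follows the same recursion as [J], driven by [Y] instead of [X]. *)
Lemma noisy_relaxation_limsup e : 0 < e ->
  \forall k \near \oo, supn (fun i => J k i - Jstar i) <= delta / (1 - beta) + e.
Proof.
move=> e0; have /andP[b0 b1] := beta01.
pose z k := supn (fun i => J k i - N k i - Jstar i).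
have Nsup e' : 0 < e' -> \forall k \near \oo, supn (N k) <= e'.
  move=> e'0; have : \forall k \near \oo, forall i, `|N k i| <= e'.
    by apply: filter_forall => i; exact: N_cvg0.
  apply: filterS => k hk.
  by apply: supn_le => //; exact: ltW.
have Jz k : supn (fun i => J k i - Jstar i) <= z k + supn (N k).
  apply: supn_le => [|i]; first by rewrite addr_ge0 ?supn_ge0.
  have -> : J k i - Jstar i = (J k i - N k i - Jstar i) + N k i by ring.
  apply: le_trans (ler_normD _ _) _; apply: lerD; last exact: le_supn.
  exact: (le_supn (fun i => J k i - N k i - Jstar i)).
(* [Y_bias] is stated through [J k]; [Jz] passes to [z k] at the cost of [beta * supn (N k)], which
   tends to 0. The coefficient is [(1 - gamma k) + gamma k * beta]. *)
have zS k : z k.+1 <=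
    (1 - (1 - beta) * gamma k) * z k + gamma k * (delta + beta * supn (N k)).
  have /andP[g0 g1] := gamma01 k.
  apply: (@le_trans _ _ ((1 - gamma k) * z k +
      gamma k * (beta * supn (fun i => J k i - Jstar i) + delta))).
    apply: supn_le => [|i].
      by rewrite addr_ge0 ?mulr_ge0 ?subr_ge0 ?supn_ge0 ?(ltW g0)//
        (le_trans (supn_ge0 _) (Y_bias k)).
    have -> : J k.+1 i - N k.+1 i - Jstar i =
        (1 - gamma k) * (J k i - N k i - Jstar i) + gamma k * (Y k i - Jstar i).
      by rewrite JS NS; ring.
    apply: le_trans (ler_normD _ _) _.
    rewrite !normrM (gtr0_norm g0) (ger0_norm (_ : 0 <= 1 - gamma k)) ?subr_ge0//.
    apply: lerD; apply: ler_wpM2l; rewrite ?subr_ge0 ?(ltW g0)//.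
      exact: (le_supn (fun i => J k i - N k i - Jstar i)).
    apply: le_trans (Y_bias k).
    exact: (le_supn (fun i => Y k i - Jstar i)).
  have := ler_wpM2l (mulr_ge0 (ltW g0) b0) (Jz k); lra.
have zlim : \forall k \near \oo, z k <= delta / (1 - beta) + e / 2.
  apply: (relaxation_limsup _ gamma01 gamma_div zS).
  - by apply/andP; split; lra.
  - move=> e' e'0; apply: filterS (Nsup _ e'0) => k hk.
    by rewrite lerD2l (le_trans _ hk)// ler_piMl ?supn_ge0// ltW.
  - by rewrite divr_gt0.
have e20 : 0 < e / 2 by rewrite divr_gt0.
apply: filterS2 zlim (Nsup _ e20) => k h1 h2.
have := Jz k; lra.
Qed.

End Pathwise.

(** * Truncation of almost surely bounded functions *)

Section Clip.
Variables (R : realType) (B : R).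

(** Turns an almost sure bound into one at every point, as [averaged_noise_cvg0] requires, without
    changing integrals. *)
Definition clip (x : R) : R := Num.max (- B) (Num.min B x).

Lemma clip_id x : `|x| <= B -> clip x = x.
Proof. by rewrite ler_norml /clip => /andP[h1 h2]; rewrite (min_idPr h2) (max_idPr h1). Qed.

Lemma clip_bound x : 0 <= B -> `|clip x| <= B.
Proof.
move=> B0; rewrite ler_norml /clip le_max lexx /= ge_max ge_min lexx /= andbT.
by rewrite (le_trans _ B0)// oppr_le0.
Qed.

Lemma measurable_clip : measurable_fun setT clip.
Proof. by apply: measurable_maxr => //; exact: measurable_minr. Qed.

Variables (dO : measure_display) (Omega : measurableType dO).
Variable Pr : probability Omega R.

Lemma Rintegral_clip (f : Omega -> R) E : measurable E -> measurable_fun setT f ->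
  {ae Pr, forall w, `|f w| <= B} ->
  \int[Pr]_(w in E) clip (f w) = \int[Pr]_(w in E) f w.
Proof.
move=> mE mf hf; congr fine; apply: ae_eq_integral => //.
- apply/measurable_EFinP/measurable_funTS.
  by apply: measurableT_comp => //; exact: measurable_clip.
- by apply/measurable_EFinP/measurable_funTS.
- by apply: filterS hf => w h _; rewrite clip_id.
Qed.

End Clip.

(** * Almost sure error bounds for the value iterates and the greedy policies *)

Theorem theorem2
  (R : realType) (S A : finType)
  (P : S -> A -> S -> R) (g : S -> A -> R) (alpha : R)
  (hP0 : forall i u j, 0 <= P i u j)
  (hP1 : forall i u, \sum_(j : S) P i u j = 1)
  (hg : forall i u, 0 <= g i u <= 1)
  (halpha : 0 < alpha < 1)
  (Jmu : (S -> A) -> (S -> R))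
  (hJmu : forall mu, Tmu P g alpha mu (Jmu mu) = Jmu mu)
  (Jstar : S -> R) (hJstar : Tbell P g alpha Jstar = Jstar)
  (d : nat) (Phi : S -> 'I_d -> R) (H : nat) (hH : (1 <= H)%N)
  (theta0 : 'I_d -> R)
  (gamma : nat -> R) (hgamma : forall k, 0 < gamma k <= 1)
  (hsum : series gamma @ \oo --> +oo)
  (hsum2 : cvgn (series (fun k => gamma k ^+ 2)))
  (dO : measure_display) (Omega : measurableType dO)
  (Pr : probability Omega R)
  (F : nat -> set (set Omega))
  (theta : nat -> Omega -> ('I_d -> R))
  (mu : nat -> Omega -> (S -> A))
  (thmu : nat -> Omega -> ('I_d -> R))
  (* filtration *)
  (hF : forall k, sub_sigma (F k))
  (hFmono : forall k, F k `<=` F k.+1)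
  (* iteration *)
  (htheta0 : forall w, theta 0%N w = theta0)
  (hgreedy : forall k w,
     Tmu P g alpha (mu k.+1 w) (iter (H - 1) (Tbell P g alpha) (Phiapp Phi (theta k w)))
     = iter H (Tbell P g alpha) (Phiapp Phi (theta k w)))
  (hupd : forall k w,
     theta k.+1 w = (fun j => (1 - gamma k) * theta k w j + gamma k * thmu k.+1 w j))
  (* adaptedness: theta_k, mu_{k+1} are F_k-measurable; the estimate
     theta^{mu_{k+1}} is part of the history up to iteration k+1 *)
  (htheta_meas : forall k j, G_measurable (F k) (fun w => theta k w j))
  (hmu_meas : forall k (pi : S -> A), F k [set w | mu k.+1 w = pi])
  (hthmu_meas : forall k j, G_measurable (F k.+1) (fun w => thmu k.+1 w j))
  (* a.s. uniform bound on the estimates *)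
  (hbound : exists C : R, forall k,
     {ae Pr, forall w, supn (Phiapp Phi (thmu k.+1 w)) <= C})
  (delta kappa : R) (hdelta : 0 < delta) (hkappa : 0 < kappa)
  (hbeta : alpha ^+ (H - 1) + kappa * (2 * alpha ^+ (H - 1) / (1 - alpha)) < 1)
  (hbias : forall k, exists Y : S -> Omega -> R,
     (forall i, is_cond_exp Pr (F k) (fun w => Phiapp Phi (thmu k.+1 w) i) (Y i)) /\
     {ae Pr, forall w,
        supn (fun i => Y i w - iter (H - 1) (Tbell P g alpha) (Phiapp Phi (theta k w)) i)
        <= kappa * supn (fun i => iter (H - 1) (Tbell P g alpha) (Phiapp Phi (theta k w)) i
                                  - Jmu (mu k.+1 w) i) + delta}) :
  let beta := alpha ^+ (H - 1) + kappa * (2 * alpha ^+ (H - 1) / (1 - alpha)) in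
  {ae Pr, forall w,
    (limn_esup (fun k => (supn (fun i => Phiapp Phi (theta k w) i - Jstar i))%:E)
       <= (delta / (1 - beta))%:E)%E /\
    (limn_esup (fun k => (supn (fun i => Jmu (mu k w) i - Jstar i))%:E)
       <= ((2 * alpha ^+ (H - 1) / (1 - alpha)) * (delta / (1 - beta)))%:E)%E}.
Proof.
move=> beta.
have /andP[a0 a1] := halpha.
pose rho := 2 * alpha ^+ (H - 1) / (1 - alpha).
have rho0 : 0 < rho by rewrite divr_gt0 ?subr_gt0// mulr_gt0// exprn_gt0.
have beta01 : 0 <= beta < 1.
  by rewrite hbeta andbT addr_ge0 ?exprn_ge0 ?(ltW a0)// mulr_ge0 ?ltW.
have [C hC] := hbound.
have [Y hY] := choice hbias.
pose J k w := Phiapp Phi (theta k w).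
pose X k w := Phiapp Phi (thmu k.+1 w).
pose G k w := iter (H - 1) (Tbell P g alpha) (J k w).
pose D k w := supn (fun i => J k w i - Jstar i).
have JS k w i : J k.+1 w i = (1 - gamma k) * J k w i + gamma k * X k w i.
  rewrite /J /X /Phiapp hupd !mulr_sumr -big_split /=.
  by apply: eq_bigr => j _; ring.
have G_star k w : supn (fun i => G k w i - Jstar i) <= alpha ^+ (H - 1) * D k w.
  exact: iter_Tbell_dist.
(* [hH] ensures that [H - 1] is followed by exactly one more application of [Tbell] to reach [H]. *)
have greedy k w : Tmu P g alpha (mu k.+1 w) (G k w) = Tbell P g alpha (G k w).
  by rewrite /G hgreedy -iterS -addn1 subnK.
have rhoE k w : 2 / (1 - alpha) * supn (fun i => G k w i - Jstar i) <= rho * D k w.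
  have -> : rho * D k w = 2 / (1 - alpha) * (alpha ^+ (H - 1) * D k w).
    by rewrite /rho; ring.
  by apply: ler_wpM2l => //; rewrite divr_ge0// subr_ge0 ltW.
have Jmu_star k w : supn (fun i => Jmu (mu k.+1 w) i - Jstar i) <= rho * D k w.
  apply: le_trans (rhoE k w).
  exact: (greedy_dist_Jstar hP0 hP1 halpha hJmu hJstar (greedy k w)).
(* Through [G k w]: its distance to [Jstar] contributes [alpha ^+ (H - 1)], and [hbias] with
   [greedy_dist_Jmu] contributes [kappa * rho] and [delta]; the two coefficients add up to
   [beta]. *)
have bias : {ae Pr, forall w, forall k,
    supn (fun i => Y k i w - Jstar i) <= beta * D k w + delta}.
  apply: ae_foralln => k; apply: filterS (hY k).2 => w h.
  have h1 := supn_triangle (G k w) (fun i => Y k i w) Jstar.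
  have h2 := G_star k w.
  have h3 := le_trans (greedy_dist_Jmu hP0 hP1 halpha hJmu hJstar (greedy k w)) (rhoE k w).
  have h4 := ler_wpM2l (ltW hkappa) h3.
  rewrite -/(J k w) -/(G k w) in h.
  by rewrite /beta -/rho; lra.
have X_bound : {ae Pr, forall w, forall k i, `|X k w i| <= `|C|}.
  apply: ae_foralln => k; apply: filterS (hC k) => w h i.
  apply: le_trans (ler_norm C); apply: le_trans h; exact: le_supn.
(* [B0] bounds every [J k], a convex combination of the initial value and the estimates; [B1] then
   bounds the conditional means through [bias]. Their sum [B] serves for both [X] and [Y]. *)
pose B0 := `|C| + supn (Phiapp Phi theta0).
pose B1 := supn Jstar + (beta * (B0 + supn Jstar) + delta).
pose B := B0 + B1.
have B00 : 0 <= B0 by rewrite addr_ge0// supn_ge0.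
have /andP[b0 _] := beta01.
have B10 : 0 <= B1.
  rewrite addr_ge0 ?supn_ge0// addr_ge0 ?(ltW hdelta)// mulr_ge0//.
  by rewrite addr_ge0// supn_ge0.
have BB : 0 <= B by rewrite addr_ge0.
have XB : {ae Pr, forall w, forall k i, `|X k w i| <= B}.
  apply: filterS X_bound => w h k i; apply: le_trans (h k i) _.
  by rewrite /B /B0 -addrA lerDl addr_ge0// supn_ge0.
have YB : {ae Pr, forall w, forall k i, `|Y k i w| <= B}.
  apply: filterS2 bias X_bound => w hb hX k i.
  have JB : forall n j, `|J n w j| <= B0.
    elim=> [|n IH] j.
      rewrite /J htheta0; apply: le_trans (le_supn _ j) _.
      by rewrite lerDr.
    have /andP[g0 g1] := hgamma n.
    rewrite JS; apply: le_trans (ler_normD _ _) _.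
    rewrite !normrM (gtr0_norm g0) (ger0_norm (_ : 0 <= 1 - gamma n)) ?subr_ge0//.
    have -> : B0 = (1 - gamma n) * B0 + gamma n * B0 by ring.
    apply: lerD; apply: ler_wpM2l; rewrite ?subr_ge0 ?(ltW g0)//.
    by apply: le_trans (hX n j) _; rewrite lerDl supn_ge0.
  have DB : D k w <= B0 + supn Jstar.
    apply: supn_le => [|j]; first by rewrite addr_ge0// supn_ge0.
    apply: le_trans (ler_normB _ _) _; apply: lerD; first exact: JB.
    exact: le_supn.
  have -> : Y k i w = Jstar i + (Y k i w - Jstar i) by ring.
  apply: le_trans (ler_normD _ _) _.
  apply: (@le_trans _ _ B1); last by rewrite lerDr.
  apply: lerD; first exact: le_supn.
  apply: le_trans (le_supn (fun i => Y k i w - Jstar i) i) _.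
  by apply: le_trans (hb k) _; rewrite lerD2r ler_wpM2l.
(* Almost surely this is [X k w i - Y k i w]; clipping both terms makes it bounded everywhere and
   keeps their integrals, which agree on events of [F k]. *)
pose W i k w := clip B (X k w i) - clip B (Y k i w).
have mX k i : G_measurable (F k.+1) (fun w => X k w i).
  by apply: G_measurable_sum => // j; exact: G_measurableZ.
have mY k i : G_measurable (F k) (Y k i) := ((hY k).1 i).1.
have mclipX k i : G_measurable (F k.+1) (fun w => clip B (X k w i)).
  exact: G_measurable_comp (@measurable_clip _ B) (mX k i).
have mclipY k i : G_measurable (F k) (fun w => clip B (Y k i w)).
  exact: G_measurable_comp (@measurable_clip _ B) (mY k i).
have noise0 i : {ae Pr, forall w, forall e, 0 < e ->
    \forall k \near \oo, `|averaged_noise gamma (W i) k w| <= e}.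
  apply: (@averaged_noise_cvg0 _ _ _ _ gamma (W i) F (B + B)) => //.
  - move=> k; apply: G_measurableD => //.
    rewrite (_ : (fun w => _) = (fun w => -1 * clip B (Y k i w))); last first.
      by apply/funext => w; rewrite mulN1r.
    apply: G_measurableZ => E mE; exact/hFmono/mclipY.
  - by move=> k w; apply: le_trans (ler_normB _ _) _; apply: lerD; exact: clip_bound.
  - move=> k E FE; have mE : measurable E by apply: (hF k).2.
    rewrite RintegralB//.
    + rewrite !Rintegral_clip//.
      * by apply/eqP; rewrite subr_eq0; apply/eqP; congr fine; rewrite (((hY k).1 i).2.2 _ FE).
      * exact: G_measurableW (mY k i).
      * by apply: filterS YB => w; apply.
      * exact: G_measurableW (mX k i).
      * by apply: filterS XB => w; apply.
    + apply: (@bounded_integrable _ _ _ _ _ B) => //.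
        exact: G_measurableW (mclipX k i).
      by move=> w; exact: clip_bound.
    + apply: (@bounded_integrable _ _ _ _ _ B) => //.
        exact: G_measurableW (mclipY k i).
      by move=> w; exact: clip_bound.
have noise : {ae Pr, forall w, forall i e, 0 < e ->
    \forall k \near \oo, `|averaged_noise gamma (W i) k w| <= e}.
  by apply: filter_forall => i; exact: noise0.
have XYB : {ae Pr, forall w, (forall k i, `|X k w i| <= B) /\
    (forall k i, `|Y k i w| <= B)} by apply: filterS2 XB YB.
apply: filterS3 bias XYB noise => w hb [hX hYw] hN.
have Dlim e : 0 < e -> \forall k \near \oo, D k w <= delta / (1 - beta) + e.
  apply: (@noisy_relaxation_limsup _ _ gamma (J^~ w) (X^~ w) (fun k i => Y k i w)
    (fun k i => averaged_noise gamma (W i) k w)) => //.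
  by move=> k i /=; rewrite /W !clip_id.
split; first exact: limn_esup_le_near.
apply: limn_esup_le_near => e e0.
(* The tolerance is divided by [rho] because [Jmu_star] multiplies it by [rho]. *)
have e'0 : 0 < e / rho by rewrite divr_gt0.
have [n _ hn] := Dlim _ e'0.
(* [Jmu_star] controls index [k.+1] by [D k], hence the shift; [mu 0] is not a greedy policy of the
   iteration and is skipped. *)
exists n.+1 => // -[//|k] /= nk.
apply: le_trans (Jmu_star k w) _.
apply: le_trans (ler_wpM2l (ltW rho0) (hn k nk)) _.
by rewrite mulrDr [rho * (e / rho)]mulrC divfK// gt_eqF.
Qed.
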